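(* Let $a\ge 0$ and $b>0$ be real numbers. The principal branch of the function $G_{a,b}(z)=\frac{1}{a+\sqrt{b-z}}$ satisfies $$G_{a,b}(z)=\frac{1}{a+\sqrt{b-z}}=\frac{1}{\pi}\int_{0}^{\infty}\frac{\sqrt{t}}{a^2+t}\,\frac{1}{b+t-z}\,dt,\qquad z\in\mathbb{C}\setminus[b,\infty).$$ Consequently, the generalized Catalan numbers of the second kind $\mathcal{C}_n(a,b)$, defined as the coefficients of the power series expansion around $x=0$ $$\frac{1}{a+\sqrt{b-x}}=\sum_{n=0}^{\infty}\mathcal{C}_n(a,b)\,x^n,$$ can be represented by $$\mathcal{C}_n(a,b)=\frac{1}{\pi}\int_{0}^{\infty}\frac{\sqrt{t}}{a^2+t}\,\frac{1}{(b+t)^{n+1}}\,dt,\qquad n\ge 0.$$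
   Context: For $z\in\mathbb{C}\setminus[b,\infty)$, the number $b-z$ lies in $\mathbb{C}\setminus(-\infty,0]$, and $\sqrt{b-z}=\exp\bigl(\tfrac12\ln(b-z)\bigr)$ denotes the principal branch of the square root (with positive real part). For $t\ge0$, $\sqrt{t}$ is the nonnegative real square root. *)

(* Defs.v *)
From Stdlib Require Import Reals.
From Coquelicot Require Import Coquelicot.

Open Scope R_scope.

Definition Cexp (z : C) : C :=
  (exp (Re z) * cos (Im z), exp (Re z) * sin (Im z)).

(* Principal argument, with values in (-PI, PI]; meaningful for z <> 0. *)
Definition Carg (z : C) : R :=
  if Rle_dec 0 (Im z) then acos (Re z / Cmod z) else - acos (Re z / Cmod z).

Definition Cln (z : C) : C := (ln (Cmod z), Carg z).

Definition Csqrt (z : C) : C := Cexp (RtoC (1 / 2) * Cln z)%C.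

Definition G (a b : R) (z : C) : C :=
  (RtoC 1 / (RtoC a + Csqrt (RtoC b - z)))%C.

(* Complement of the cut [b, +oo) on the real axis. *)
Definition off_cut (b : R) (z : C) : Prop := ~ (Im z = 0 /\ b <= Re z).

(* Improper integrals over (0, +oo).  The lower end is the limit [at_right 0]
   and not the point 0, because sqrt t / (a^2 + t) is unbounded near 0 when
   a = 0.  [RInt_gen] is total, so convergence is stated by [ex_RInt_gen]. *)
Definition ex_int_0_infty {V : NormedModule R_AbsRing} (f : R -> V) : Prop :=
  ex_RInt_gen f (at_right 0) (Rbar_locally p_infty).

Definition int_0_infty {V : CompleteNormedModule R_AbsRing} (f : R -> V) : V :=
  RInt_gen f (at_right 0) (Rbar_locally p_infty).

Definition G_integrand (a b : R) (z : C) (t : R) : C :=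
  (RtoC (sqrt t / (a ^ 2 + t)) * (RtoC 1 / (RtoC b + RtoC t - z)))%C.

(* [c] is the sequence of coefficients of the expansion of G a b around 0. *)
Definition is_catalan2 (a b : R) (c : nat -> C) : Prop :=
  locally (RtoC 0)
    (fun x : C =>
       is_pseries (K := C_AbsRing) (V := C_NormedModule) c x (G a b x)).

Definition catalan2_integrand (a b : R) (n : nat) (t : R) : R :=
  sqrt t / (a ^ 2 + t) * (1 / (b + t) ^ (n + 1)).

(* Main.v *)
Require Import Defs.
From Stdlib Require Import Reals Lra Lia.
From Coquelicot Require Import Coquelicot.

Open Scope R_scope.

(** Put s = sqrt (b - z), so that Re s > 0 and s^2 = b - z.  The integral becomes
    the integral of sqrt t / ((a^2 + t) (t + s^2)), and with u = sqrt t it is that of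
    2 u^2 / ((a^2 + u^2) (u^2 + s^2)).  For s <> a, partial fractions give
      2 / (s^2 - a^2) * (s^2 / (u^2 + s^2) - a^2 / (u^2 + a^2)),
    and since s^2 / (u^2 + s^2) has integral s PI / 2 over (0, +oo), the total is
    PI (s - a) / (s^2 - a^2) = PI / (a + s).  The case s = a is real and has an
    elementary primitive.  [arctan_primitive] supplies the primitive
    s * arctan (u / s) for complex s as a difference of two logarithms, and
    [stieltjes_kernel_integral] evaluates the integral.

    For the coefficients, no differentiation under the integral sign is used.
    Expanding 1 / (b + t - x) as a finite geometric progression in x / (b + t) writes
    G x minus the partial sum of C_n x^n, where C_n is the asserted integral, as an
    integral with the factor (x / (b + t))^(N+1)
    ([remainder_is_RInt_gen]).  On the disk |x| < b / 2 that factor is at most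
    2^-(N+1) while |b + t - x| >= (b + t) / 2, so the remainder tends to 0
    ([remainder_bound]) and the C_n are coefficients of an expansion of G.  Any other
    sequence of coefficients agrees with them: on the real axis, the real and imaginary
    parts are real power series with the same sum ([real_pseries_unique]). *)

(** * Complex numbers as a real normed space *)

Lemma norm_C_R (z : C) : norm (V := C_R_NormedModule) z = Cmod z.
Proof.
  unfold norm; simpl. unfold prod_norm, Cmod, norm; simpl. unfold abs; simpl.
  f_equal.
  generalize (Rsqr_abs (fst z)) (Rsqr_abs (snd z)); unfold Rsqr; lra.
Qed.

Lemma scal_R_C (r : R) (z : C) : scal (V := C_R_NormedModule) r z = (RtoC r * z)%C.
Proof. apply injective_projections; simpl; unfold scal; simpl; unfold mult; simpl; ring. Qed.

(** Real-linear maps are the common tool below: multiplication by a constant, [RtoC], [Re]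
    and [Im] carry derivatives, limits and integrals between R and C. *)
Lemma is_linear_Cmult (k : C) :
  is_linear (U := C_R_NormedModule) (V := C_R_NormedModule) (fun z => (k * z)%C).
Proof.
  split.
  - intros x y. exact (Cmult_plus_distr_l k x y).
  - intros r x. apply injective_projections; simpl; unfold scal, mult; simpl; unfold mult; simpl; ring.
  - exists (Cmod k + 1). split.
    + generalize (Cmod_ge_0 k); lra.
    + intros x.
      rewrite !norm_C_R, Cmod_mult.
      apply Rmult_le_compat_r; [apply Cmod_ge_0 | lra].
Qed.

Lemma is_linear_RtoC :
  is_linear (U := R_NormedModule) (V := C_R_NormedModule) RtoC.
Proof.
  apply (is_linear_prod (K := R_AbsRing) (fun x : R_NormedModule => x : R_NormedModule)
    (fun _ : R_NormedModule => zero : R_NormedModule)).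
  - apply is_linear_id.
  - apply is_linear_zero.
Qed.

Lemma is_linear_Re :
  is_linear (U := C_R_NormedModule) (V := R_NormedModule) Re.
Proof. exact (is_linear_fst (K := R_AbsRing) (U := R_NormedModule) (V := R_NormedModule)). Qed.

(** A linear map commutes with finite sums; continuity then carries this over to the
    integral and to the improper integral. *)
Lemma Riemann_sum_linear {U V : NormedModule R_AbsRing} (L : U -> V) (f : R -> U) ptd :
  is_linear L -> Riemann_sum (fun t => L (f t)) ptd = L (Riemann_sum f ptd).
Proof.
  intros HL. revert ptd. apply SF_cons_ind.
  - intros x. symmetry. exact (linear_zero L HL).
  - intros h s IH. rewrite !Riemann_sum_cons, IH, (linear_plus L HL), (linear_scal L HL). reflexivity.
Qed.

Lemma is_RInt_linear {U V : NormedModule R_AbsRing} (L : U -> V) (f : R -> U) a b l :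
  is_linear L -> is_RInt f a b l -> is_RInt (fun t => L (f t)) a b (L l).
Proof.
  intros HL Hf. unfold is_RInt in *.
  apply filterlim_ext with (fun ptd => L (scal (sign (b - a)) (Riemann_sum f ptd))).
  - intros ptd. now rewrite (linear_scal L HL), (Riemann_sum_linear L f ptd HL).
  - eapply filterlim_comp; [exact Hf | exact (linear_cont L l HL)].
Qed.

Lemma is_RInt_gen_linear {U V : NormedModule R_AbsRing} (L : U -> V) (f : R -> U)
  Fa Fb {FFa : Filter Fa} {FFb : Filter Fb} l :
  is_linear L -> is_RInt_gen f Fa Fb l -> is_RInt_gen (fun t => L (f t)) Fa Fb (L l).
Proof.
  intros HL Hf P HP.
  assert (H : filter_prod Fa Fb (fun ab => exists y, is_RInt f (fst ab) (snd ab) y /\ P (L y)))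
    by exact (Hf _ (linear_cont L l HL P HP)).
  refine (filter_imp _ _ _ H). intros x [y [Hy1 Hy2]].
  exists (L y). split; [now apply is_RInt_linear | exact Hy2].
Qed.

Lemma is_derive_pair (f g : R -> R) (t f' g' : R) :
  is_derive f t f' -> is_derive g t g' ->
  is_derive (V := C_R_NormedModule) (fun u => (f u, g u)) t (f', g').
Proof.
  intros Hf Hg. unfold is_derive.
  apply (filterdiff_comp'_2 (K := R_AbsRing) (T := R_NormedModule) (U := R_NormedModule)
    (V := R_NormedModule) (W := C_R_NormedModule) f g (fun x y => (x, y)) t
    (fun y => scal y f') (fun y => scal y g') (fun x y => (x, y)) Hf Hg).
  apply filterdiff_linear.
  apply (is_linear_prod (K := R_AbsRing) (T := prod_NormedModule R_AbsRing R_NormedModule R_NormedModule)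
   (U := R_NormedModule) (V := R_NormedModule)).
  apply is_linear_fst. apply is_linear_snd.
Qed.

Lemma is_derive_linear {U V : NormedModule R_AbsRing} (L : U -> V) (f : R -> U) t f' :
  is_linear L -> is_derive f t f' -> is_derive (fun u => L (f u)) t (L f').
Proof.
  intros HL Hf.
  eapply filterdiff_ext_lin.
  apply (filterdiff_comp' f L t _ L Hf (filterdiff_linear L HL)).
  intros y. simpl. apply (linear_scal L HL).
Qed.

Lemma filterlim_pair_C {T} {F : (T -> Prop) -> Prop} {FF : Filter F} (f g : T -> R) (x y : R) :
  filterlim f F (locally x) -> filterlim g F (locally y) ->
  filterlim (fun u => (f u, g u)) F (locally (T := C_R_NormedModule) (x, y)).
Proof.
  intros Hf Hg P [eps HP].
  refine (filter_imp (F := F) _ _ _ (filter_and (F := F) (fun u => ball x eps (f u)) (fun u => ball y eps (g u))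
    (Hf _ (locally_ball x eps)) (Hg _ (locally_ball y eps)))).
  intros u [H1 H2]. apply HP. split; assumption.
Qed.

(** * Improper integrals over the positive half-line *)

(** The filter of intervals (x, y) along which an integral over (0, +oo) converges. *)
Definition zero_infty := filter_prod (at_right 0) (Rbar_locally p_infty).

(** Intervals close to (0, +oo) lie in the open half-line and are positively oriented, so
    everything below needs its hypotheses on the integrand only for t > 0. *)
Lemma zero_infty_ordered : zero_infty (fun xy => 0 < fst xy <= snd xy).
Proof.
  exists (fun x => 0 < x < 1) (fun y => 1 < y).
  - exists (mkposreal 1 Rlt_0_1). intros x Hx Hx'.
    change (Rabs (x - 0) < 1) in Hx. apply Rabs_def2 in Hx. lra.
  - now exists 1.
  - intros x y Hx Hy. simpl. lra.
Qed.

(** The fundamental theorem of calculus on [x, y], followed by the limit in both ends. *)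
Lemma is_RInt_gen_antiderivative {V : CompleteNormedModule R_AbsRing} (F f : R -> V) (l0 l : V) :
  (forall t, 0 < t -> is_derive F t (f t)) ->
  (forall t, 0 < t -> continuous f t) ->
  filterlim F (at_right 0) (locally l0) ->
  filterlim F (Rbar_locally p_infty) (locally l) ->
  is_RInt_gen f (at_right 0) (Rbar_locally p_infty) (minus l l0).
Proof.
  intros HF Hf H0 H P HP.
  assert (HL : filterlim (fun xy : R * R => minus (F (snd xy)) (F (fst xy))) zero_infty
                (locally (minus l l0))).
  { apply (filterlim_comp_2 (G := locally l) (H := locally (opp l0))
      (fun xy : R * R => F (snd xy)) (fun xy : R * R => opp (F (fst xy))) plus).
    - eapply filterlim_comp; [apply filterlim_snd | exact H].
    - eapply filterlim_comp; [|exact (filterlim_opp (V := V) l0)].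
      eapply filterlim_comp; [apply filterlim_fst | exact H0].
    - exact (filterlim_plus (V := V) l (opp l0)). }
  refine (filter_imp _ _ _ (filter_and _ _ zero_infty_ordered (HL P HP))).
  intros [x y] [[Hx Hy] Hxy]. simpl in *.
  exists (minus (F y) (F x)). split; [|exact Hxy].
  apply is_RInt_derive; rewrite Rmin_left, Rmax_right by lra; intros t Ht;
    [apply HF | apply Hf]; lra.
Qed.

Lemma is_RInt_gen_ext_positive {V : NormedModule R_AbsRing} (f g : R -> V) (l : V) :
  (forall t, 0 < t -> f t = g t) ->
  is_RInt_gen f (at_right 0) (Rbar_locally p_infty) l ->
  is_RInt_gen g (at_right 0) (Rbar_locally p_infty) l.
Proof.
  intros Hfg. apply is_RInt_gen_ext.
  refine (filter_imp (F := zero_infty) _ _ _ zero_infty_ordered).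
  intros [x y] Hxy t Ht. simpl in *. apply Hfg.
  rewrite Rmin_left in Ht by lra. lra.
Qed.

(** Cauchy's criterion: changing one endpoint changes the integral of f by at most the
    change in the integral of g, and the latter is small because g is integrable. *)
Lemma ex_int_0_infty_dominated (f g : R -> R) :
  (forall t, 0 < t -> continuous f t) ->
  (forall t, 0 < t -> Rabs (f t) <= g t) ->
  ex_int_0_infty g -> ex_int_0_infty f.
Proof.
  intros Hf Hfg [l Hl].
  assert (Hex : forall x y, 0 < x -> 0 < y -> ex_RInt f x y).
  { intros x y Hx Hy. apply (ex_RInt_continuous (V := R_CompleteNormedModule)).
    intros t [Ht _]. apply Hf. unfold Rmin in Ht; destruct Rle_dec in Ht; lra. }
  assert (HQ : forall eps : posreal, exists P, zero_infty P /\
     forall u v, P u -> P v -> ball (RInt f (fst u) (snd u)) eps (RInt f (fst v) (snd v))).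
  { intros eps.
    assert (He : 0 < eps / 4) by (generalize (cond_pos eps); lra).
    destruct (filter_and _ _ zero_infty_ordered
      (Hl _ (locally_ball l (mkposreal _ He)))) as [Q S HQ HS HQS].
    exists (fun xy => Q (fst xy) /\ S (snd xy)). split.
    - now exists Q S.
    - assert (HG : forall x y, Q x -> S y -> exists G, is_RInt g x y G /\ Rabs (G - l) < eps / 4).
      { intros x y Hx Hy. destruct (HQS x y Hx Hy) as [_ H]. exact H. }
      assert (Hpos : forall x y, Q x -> S y -> 0 < x <= y).
      { intros x y Hx Hy. destruct (HQS x y Hx Hy) as [H _]. exact H. }
      assert (Hbd : forall x y G, 0 < x -> x <= y -> is_RInt g x y G -> Rabs (RInt f x y) <= G).
      { intros x y G Hx Hy HG'.
        apply (norm_RInt_le f g x y (RInt f x y) G Hy); [|apply (RInt_correct (V := R_CompleteNormedModule)), Hex; lra|exact HG'].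
        intros t Ht. apply Hfg. lra. }
      (* Two intervals in Q x S with the same right end have g-integrals within eps / 4 of l,
         so that the integral of g between the left ends is below eps / 2. *)
      assert (Hx1 : forall x x' y, Q x -> Q x' -> S y -> x <= x' -> Rabs (RInt f x x') < eps / 2).
      { intros x x' y Hx Hx' Hy Hxx.
        destruct (HG x y Hx Hy) as [G1 [HG1 E1]]. destruct (HG x' y Hx' Hy) as [G2 [HG2 E2]].
        assert (H : is_RInt g x x' (G1 - G2)).
        { apply (is_RInt_Chasles g x y x' G1 (- G2) HG1). exact (is_RInt_swap _ _ _ _ HG2). }
        apply Rle_lt_trans with (G1 - G2).
        - apply Hbd; [apply (Hpos x y)| |]; auto.
        - apply Rabs_def2 in E1. apply Rabs_def2 in E2. lra. }
      assert (Hy1 : forall x y y', Q x -> S y -> S y' -> y <= y' -> Rabs (RInt f y y') < eps / 2).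
      { intros x y y' Hx Hy Hy' Hyy.
        destruct (HG x y Hx Hy) as [G1 [HG1 E1]]. destruct (HG x y' Hx Hy') as [G2 [HG2 E2]].
        assert (H : is_RInt g y y' (- G1 + G2)).
        { apply (is_RInt_Chasles g y x y' (- G1) G2); [|exact HG2]. exact (is_RInt_swap _ _ _ _ HG1). }
        apply Rle_lt_trans with (- G1 + G2).
        - apply Hbd; [generalize (Hpos x y Hx Hy); lra| |]; auto.
        - apply Rabs_def2 in E1. apply Rabs_def2 in E2. lra. }
      intros [x y] [x' y'] [Hx Hy] [Hx' Hy']; simpl in *.
      assert (P1 := Hpos x y Hx Hy). assert (P2 := Hpos x' y' Hx' Hy').
      change (Rabs (RInt f x' y' - RInt f x y) < eps).
      assert (C1 : RInt f x x' + RInt f x' y' = RInt f x y').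
      { apply (RInt_Chasles (V := R_CompleteNormedModule) f); apply Hex; lra. }
      assert (C2 : RInt f x y + RInt f y y' = RInt f x y').
      { apply (RInt_Chasles (V := R_CompleteNormedModule) f); apply Hex; lra. }
      replace (RInt f x' y' - RInt f x y) with (RInt f y y' - RInt f x x') by lra.
      assert (B1 : Rabs (RInt f x x') < eps / 2).
      { destruct (Rle_dec x x') as [H|H].
        - now apply (Hx1 x x' y).
        - assert (E : - RInt f x' x = RInt f x x') by (apply (opp_RInt_swap (V := R_CompleteNormedModule)), Hex; lra).
          rewrite <- E, Rabs_Ropp. apply (Hx1 x' x y); auto; lra. }
      assert (B2 : Rabs (RInt f y y') < eps / 2).
      { destruct (Rle_dec y y') as [H|H].
        - now apply (Hy1 x y y').
        - assert (E : - RInt f y' y = RInt f y y') by (apply (opp_RInt_swap (V := R_CompleteNormedModule)), Hex; lra).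
          rewrite <- E, Rabs_Ropp. apply (Hy1 x y' y); auto; lra. }
      generalize (Rabs_triang (RInt f y y') (- RInt f x x')). rewrite Rabs_Ropp.
      unfold Rminus. lra. }
  destruct (proj1 (filterlim_locally_cauchy (U := R_CompleteNormedModule) (F := zero_infty)
    (fun xy => RInt f (fst xy) (snd xy))) HQ) as [L HL].
  exists L. intros P HP.
  refine (filter_imp _ _ _ (filter_and _ _ zero_infty_ordered (HL P HP))).
  intros [x y] [Hxy H]. simpl in *.
  exists (RInt f x y). split; [|exact H].
  apply (RInt_correct (V := R_CompleteNormedModule)), Hex; lra.
Qed.

(** * A primitive of s^2 / (u^2 + s^2) for complex s *)

(** A branch of log (u + w) for Im w <> 0, up to an additive constant: the argument of
    u + w is PI / 2 - atan ((u + Re w) / Im w) in the upper half-plane, and the sign of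
    Im w only changes the constant. *)
Definition log_primitive (w : C) (u : R) : C :=
  (ln ((u + Re w) ^ 2 + Im w ^ 2) / 2, - atan ((u + Re w) / Im w)).

Lemma is_derive_log_primitive (w : C) (u : R) :
  Im w <> 0 -> is_derive (V := C_R_NormedModule) (log_primitive w) u (/ (RtoC u + w))%C.
Proof.
  destruct w as [x y]. unfold log_primitive. simpl Re. simpl Im. intros Hy.
  assert (Hs : 0 < (u + x) ^ 2 + y ^ 2).
  { assert (0 < y ^ 2) by now apply pow2_gt_0. assert (H1 := pow2_ge_0 (u + x)). lra. }
  replace (/ (RtoC u + (x, y)))%C with
    ((u + x) / ((u + x) ^ 2 + y ^ 2), - (y / ((u + x) ^ 2 + y ^ 2))).
  2:{ unfold Cinv, RtoC, Cplus; apply injective_projections; simpl; field; simpl in Hs; lra. }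
  apply is_derive_pair.
  - auto_derive; [exact Hs | field; lra].
  - auto_derive; [exact I |]. field. split; [lra | exact Hy].
Qed.

Lemma filterlim_Rinv_p_infty : filterlim Rinv (Rbar_locally p_infty) (locally 0).
Proof. exact (filterlim_Rbar_inv p_infty ltac:(discriminate)). Qed.

(** Since u^2 + s^2 = (u - i s) (u + i s), this is 2 i arctan (u / s) for a suitable branch. *)
Definition log_primitive_diff (s : C) (u : R) : C :=
  (log_primitive (- (Ci * s)) u - log_primitive (Ci * s) u)%C.

(** For large u the difference is a function of 1 / u that is continuous at 0: the
    terms ln u cancel in the real part, and atan y = PI / 2 - atan (1 / y) for y > 0 turns
    the imaginary part into PI minus two terms that vanish at infinity. *)
Lemma lim_log_diff (s : C) : 0 < Re s ->
  filterlim (log_primitive_diff s) (Rbar_locally p_infty)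
    (locally (T := C_R_NormedModule) (RtoC PI * Ci)%C).
Proof.
  destruct s as [p q]. simpl. intros Hp.
  pose (re v := (ln ((1 + q * v) ^ 2 + (p * v) ^ 2) / 2 - ln ((1 - q * v) ^ 2 + (p * v) ^ 2) / 2)).
  pose (im v := PI - atan (p * v / (1 + q * v)) - atan (p * v / (1 - q * v))).
  apply filterlim_ext_loc with (fun u => (re (/ u), im (/ u))).
  - exists (Rabs q). intros u Hu.
    assert (Hq := Rle_abs q). assert (Hq' := Rle_abs (- q)). rewrite Rabs_Ropp in Hq'.
    assert (H0 : 0 < u) by (generalize (Rabs_pos q); lra).
    assert (Hln : forall r, 0 < u + r ->
      ln ((u + r) ^ 2 + p ^ 2) = 2 * ln u + ln ((1 + r * / u) ^ 2 + (p * / u) ^ 2)).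
    { intros r Hr.
      replace ((u + r) ^ 2 + p ^ 2) with (u ^ 2 * ((1 + r * / u) ^ 2 + (p * / u) ^ 2)) by (field; lra).
      assert (0 < / u) by now apply Rinv_0_lt_compat.
      rewrite ln_mult, ln_pow; [simpl; lra | lra | nra |].
      assert (0 < (p * / u) ^ 2) by (apply pow_lt; nra).
      assert (H3 := pow2_ge_0 (1 + r * / u)). lra. }
    assert (Hat : forall r, 0 < u + r ->
      atan ((u + r) / p) = PI / 2 - atan (p * / u / (1 + r * / u))).
    { intros r Hr. rewrite <- atan_inv.
      - f_equal. field. repeat split; lra.
      - apply Rdiv_lt_0_compat.
        + apply Rdiv_lt_0_compat; lra.
        + replace (1 + r * / u) with ((u + r) / u) by (field; lra). apply Rdiv_lt_0_compat; lra. }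
    unfold log_primitive_diff, log_primitive, re, im.
    apply injective_projections; cbn [Re Im fst snd Copp Cmult Cplus Cminus Ci].
    + replace (u + - (0 * p - 1 * q)) with (u + q) by ring.
      replace (u + (0 * p - 1 * q)) with (u + - q) by ring.
      replace (- (0 * q + 1 * p)) with (- p) by ring.
      replace (0 * q + 1 * p) with p by ring.
      replace ((- p) ^ 2) with (p ^ 2) by ring.
      rewrite (Hln q), (Hln (- q)) by lra.
      replace (1 + - q * / u) with (1 - q * / u) by ring. simpl. lra.
    + replace (u + - (0 * p - 1 * q)) with (u + q) by ring.
      replace (u + (0 * p - 1 * q)) with (u + - q) by ring.
      replace ((u + q) / - (0 * q + 1 * p)) with (- ((u + q) / p)) by (field; lra).
      replace (0 * q + 1 * p) with p by ring.
      rewrite atan_opp, (Hat q), (Hat (- q)) by lra.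
      replace (1 + - q * / u) with (1 - q * / u) by ring. lra.
  - replace (RtoC PI * Ci)%C with ((re 0, im 0) : C).
    2:{ unfold re, im. apply injective_projections; simpl.
        - replace (1 - q * 0) with (1 + q * 0) by ring. lra.
        - replace (p * 0 / (1 + q * 0)) with 0 by (field; lra).
          replace (p * 0 / (1 - q * 0)) with 0 by (field; lra). rewrite atan_0. lra. }
    apply filterlim_pair_C; (eapply filterlim_comp; [apply filterlim_Rinv_p_infty|]);
      apply (ex_derive_continuous (V := R_NormedModule)).
    + unfold re. auto_derive. repeat split; lra.
    + unfold im. auto_derive. repeat split; lra.
Qed.

Lemma sqr_plus_neq_0 (s : C) (u : R) : 0 < Re s -> (RtoC u * RtoC u + s * s)%C <> RtoC 0.
Proof.
  destruct s as [p q]. simpl. intros Hp H. injection H as H1 H2.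
  assert (q = 0) by nra. subst q. nra.
Qed.

(** The primitive is s * arctan (u / s), normalised to vanish at 0.  The case s = 0 is
    included so that the lemma also applies to s = a when a = 0. *)
Lemma arctan_primitive (s : C) : s = RtoC 0 \/ 0 < Re s ->
  exists B : R -> C,
    continuous (U := C_R_NormedModule) B 0 /\ B 0 = RtoC 0 /\
    (forall u, 0 < u ->
      is_derive (V := C_R_NormedModule) B u (s * s / (RtoC u * RtoC u + s * s))%C) /\
    filterlim B (Rbar_locally p_infty) (locally (T := C_R_NormedModule) (RtoC (PI / 2) * s)%C).
Proof.
  intros [-> | Hs].
  - exists (fun _ => RtoC 0).
    split; [|split; [|split]].
    + apply continuous_const.
    + reflexivity.
    + intros u Hu. replace (RtoC 0 * RtoC 0 / (RtoC u * RtoC u + RtoC 0 * RtoC 0))%C with (zero : C_R_NormedModule).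
      * apply is_derive_const.
      * unfold Cdiv. rewrite Cmult_0_l, Cmult_0_l. reflexivity.
    + rewrite Cmult_0_r. apply filterlim_const.
  - pose (B u := (s / (RtoC 2 * Ci) * log_primitive_diff s u)%C).
    assert (Hi : Ci <> RtoC 0) by (intros H; injection H; lra).
    assert (H2 : RtoC 2 <> RtoC 0) by (intros H; injection H; lra).
    assert (HB : forall u, is_derive (V := C_R_NormedModule) B u
        (s * s / (RtoC u * RtoC u + s * s))%C).
    { intros u.
      assert (HI : Im (Ci * s) <> 0) by (destruct s as [p q]; simpl in *; lra).
      assert (HI' : Im (- (Ci * s)) <> 0) by (destruct s as [p q]; simpl in *; lra).
      assert (Hn := sqr_plus_neq_0 s u Hs).
      assert (HCi : (Ci * Ci = - RtoC 1)%C) by (apply injective_projections; simpl; ring).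
      assert (Hf : ((RtoC u - Ci * s) * (RtoC u + Ci * s) = RtoC u * RtoC u + s * s)%C).
      { transitivity (RtoC u * RtoC u - (Ci * Ci) * (s * s))%C; [ring|]. rewrite HCi. ring. }
      assert (N1 : (RtoC u - Ci * s)%C <> RtoC 0) by (intros E; apply Hn; rewrite <- Hf, E; ring).
      assert (N2 : (RtoC u + Ci * s)%C <> RtoC 0) by (intros E; apply Hn; rewrite <- Hf, E; ring).
      replace (s * s / (RtoC u * RtoC u + s * s))%C with
        (s / (RtoC 2 * Ci) * (/ (RtoC u + - (Ci * s)) - / (RtoC u + Ci * s)))%C.
      - apply (is_derive_linear (U := C_R_NormedModule) (V := C_R_NormedModule) _ _ _ _ (is_linear_Cmult _)).
        apply (is_derive_minus (K := R_AbsRing) (V := C_R_NormedModule));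
          now apply is_derive_log_primitive.
      - rewrite <- Hf. field. repeat split; try assumption. }
    exists B. split; [|split; [|split]].
    + apply (ex_derive_continuous (K := R_AbsRing) (V := C_R_NormedModule)). eexists. apply HB.
    + unfold B, log_primitive_diff, log_primitive.
      destruct s as [p q]. simpl Re. simpl Im.
      match goal with |- (_ * ?d)%C = _ => replace d with (RtoC 0); [ring|] end.
      apply injective_projections; cbn [fst snd Copp Cminus Cplus RtoC].
      * replace ((0 + - (0 * p - 1 * q)) ^ 2 + (- (0 * q + 1 * p)) ^ 2)
         with ((0 + (0 * p - 1 * q)) ^ 2 + (0 * q + 1 * p) ^ 2) by ring. ring.
      * simpl in Hs. replace ((0 + - (0 * p - 1 * q)) / - (0 * q + 1 * p))
         with ((0 + (0 * p - 1 * q)) / (0 * q + 1 * p)) by (field; lra). ring.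
    + intros u _. apply HB.
    + replace (RtoC (PI / 2) * s)%C with (s / (RtoC 2 * Ci) * (RtoC PI * Ci))%C.
      * unfold B. eapply filterlim_comp; [now apply lim_log_diff|].
        exact (linear_cont (U := C_R_NormedModule) (V := C_R_NormedModule) _ _ (is_linear_Cmult _)).
      * rewrite RtoC_div by lra. field. exact Hi.
Qed.

(** * The Stieltjes integral of the kernel *)

(** With t = u^2, sqrt t dt = 2 u^2 du; partial fractions express the primitive through those
    of [arctan_primitive] for s and for a. *)
Lemma kernel_primitive (a : R) (s : C) : 0 <= a -> 0 < Re s ->
  exists H : R -> C,
    continuous (U := C_R_NormedModule) H 0 /\ H 0 = RtoC 0 /\
    (forall u, 0 < u -> is_derive (V := C_R_NormedModule) H u
       (RtoC 2 * (RtoC u * RtoC u) /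
         ((RtoC a * RtoC a + RtoC u * RtoC u) * (RtoC u * RtoC u + s * s)))%C) /\
    filterlim H (Rbar_locally p_infty) (locally (T := C_R_NormedModule) (RtoC PI / (RtoC a + s))%C).
Proof.
  intros Ha Hs.
  assert (Has : (RtoC a + s)%C <> RtoC 0).
  { intros E. apply (f_equal Re) in E. destruct s as [p q]. simpl in *. lra. }
  assert (H2 : RtoC 2 <> RtoC 0) by (intros H; injection H; lra).
  assert (Hu2 : forall u, 0 < u -> (RtoC a * RtoC a + RtoC u * RtoC u)%C <> RtoC 0).
  { intros u Hu E. apply (f_equal Re) in E. simpl in E. nra. }
  (* Partial fractions break down on the double pole s = a; there a > 0 and
     atan (u / a) / a - u / (u^2 + a^2) is a primitive. *)
  destruct (Ceq_dec s (RtoC a)) as [E | Ne].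
  - subst s. simpl in Hs.
    assert (Ha0 : RtoC a <> RtoC 0) by (intros H; injection H; lra).
    exists (fun u => RtoC (atan (u / a) / a - u / (u ^ 2 + a ^ 2))).
    assert (HN : forall u, 0 < u ^ 2 + a ^ 2) by (intros u; assert (h := pow2_ge_0 u); nra).
    assert (HH : forall u, is_derive (fun u => atan (u / a) / a - u / (u ^ 2 + a ^ 2)) u
      (2 * (u * u) / ((a * a + u * u) * (u * u + a * a)))).
    { intros u. assert (h := HN u). auto_derive.
      - repeat split; simpl in h; lra.
      - field. simpl in h. repeat split; nra. }
    split; [|split; [|split]].
    + apply (ex_derive_continuous (K := R_AbsRing) (V := C_R_NormedModule)).
      eexists. apply (is_derive_linear (U := R_NormedModule) (V := C_R_NormedModule) _ _ _ _ is_linear_RtoC (HH 0)).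
    + f_equal. replace (0 / a) with 0 by (field; lra). rewrite atan_0. field. repeat split; nra.
    + intros u Hu.
      assert (h := HN u).
      replace (RtoC 2 * (RtoC u * RtoC u) /
         ((RtoC a * RtoC a + RtoC u * RtoC u) * (RtoC u * RtoC u + RtoC a * RtoC a)))%C
       with (RtoC (2 * (u * u) / ((a * a + u * u) * (u * u + a * a)))).
      * apply (is_derive_linear (U := R_NormedModule) (V := C_R_NormedModule) _ _ _ _ is_linear_RtoC (HH u)).
      * rewrite RtoC_div, !RtoC_mult, !RtoC_plus, !RtoC_mult by nra. reflexivity.
    + replace (RtoC PI / (RtoC a + RtoC a))%C with (RtoC (PI / (a + a))).
      2:{ rewrite RtoC_div, RtoC_plus by lra. reflexivity. }
      pose (g v := (PI / 2 - atan (a * v)) / a - v / (1 + (a * v) ^ 2)).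
      apply filterlim_ext_loc with (fun u => RtoC (g (/ u))).
      * exists 0. intros u Hu. assert (h := HN u). unfold g. f_equal.
        replace (a * / u) with (/ (u / a)) by (field; lra).
        rewrite atan_inv by (apply Rdiv_lt_0_compat; lra).
        field. simpl in *. repeat split; nra.
      * replace (PI / (a + a)) with (g 0).
        2:{ unfold g. rewrite Rmult_0_r, atan_0. field. lra. }
        eapply filterlim_comp; [|exact (linear_cont (U := R_NormedModule) (V := C_R_NormedModule) _ _ is_linear_RtoC)].
        eapply filterlim_comp; [apply filterlim_Rinv_p_infty|].
        apply (ex_derive_continuous (V := R_NormedModule)). unfold g. auto_derive.
        simpl. repeat split; lra.
  - destruct (arctan_primitive s (or_intror Hs)) as [B [B1 [B2 [B3 B4]]]].
    destruct (arctan_primitive (RtoC a)) as [A [A1 [A2 [A3 A4]]]].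
    { simpl. destruct Ha as [Ha|Ha]; [now right | left; now rewrite Ha]. }
    assert (Hd : (s - RtoC a)%C <> RtoC 0).
    { intros E. apply Ne. replace s with (s - RtoC a + RtoC a)%C by ring. rewrite E. ring. }
    pose (k := (RtoC 2 / ((s - RtoC a) * (RtoC a + s)))%C).
    exists (fun u => (k * minus (G := C_R_NormedModule) (B u) (A u))%C).
    assert (Hk := is_linear_Cmult k).
    split; [|split; [|split]].
    + apply (continuous_comp (V := C_R_NormedModule) (W := C_R_NormedModule)
        (fun u => minus (G := C_R_NormedModule) (B u) (A u)) (fun z => k * z)%C).
      * now apply (continuous_minus (V := C_R_NormedModule)).
      * exact (linear_cont _ _ Hk).
    + rewrite B2, A2. change (k * (RtoC 0 - RtoC 0) = RtoC 0)%C. ring.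
    + intros u Hu.
      assert (N1 := Hu2 u Hu). assert (N2 := sqr_plus_neq_0 s u Hs).
      replace (RtoC 2 * (RtoC u * RtoC u) /
         ((RtoC a * RtoC a + RtoC u * RtoC u) * (RtoC u * RtoC u + s * s)))%C
       with (k * (s * s / (RtoC u * RtoC u + s * s) - RtoC a * RtoC a / (RtoC u * RtoC u + RtoC a * RtoC a)))%C.
      * apply (is_derive_linear (U := C_R_NormedModule) (V := C_R_NormedModule) _ _ _ _ Hk).
        apply (is_derive_minus (K := R_AbsRing) (V := C_R_NormedModule)); auto.
      * unfold k. field. repeat split; try assumption.
    + replace (RtoC PI / (RtoC a + s))%C with (k * (RtoC (PI / 2) * s - RtoC (PI / 2) * RtoC a))%C.
      * eapply filterlim_comp; [|exact (linear_cont _ _ Hk)].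
        apply (filterlim_comp_2 (G := locally (T := C_R_NormedModule) (RtoC (PI / 2) * s)%C)
           (H := locally (T := C_R_NormedModule) (opp (RtoC (PI / 2) * RtoC a)%C)) B (fun u => opp (A u))
           (plus (G := C_R_NormedModule))).
        -- exact B4.
        -- eapply filterlim_comp; [exact A4 | exact (filterlim_opp (V := C_R_NormedModule) _)].
        -- exact (filterlim_plus (V := C_R_NormedModule) _ _).
      * unfold k. rewrite RtoC_div by lra. field. repeat split; assumption.
Qed.

(** The change of variable is made in the primitive: H (sqrt t) has the integrand as
    derivative. *)
Lemma stieltjes_kernel_integral (a : R) (s : C) : 0 <= a -> 0 < Re s ->
  is_RInt_gen (V := C_R_NormedModule)
    (fun t => RtoC (sqrt t / (a ^ 2 + t)) * (RtoC 1 / (RtoC t + s * s)))%C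
    (at_right 0) (Rbar_locally p_infty) (RtoC PI / (RtoC a + s))%C.
Proof.
  intros Ha Hs.
  destruct (kernel_primitive a s Ha Hs) as [H [H1 [H2 [H3 H4]]]].
  replace (RtoC PI / (RtoC a + s))%C
    with (minus (G := C_R_NormedModule) (RtoC PI / (RtoC a + s))%C (RtoC 0)).
  2:{ change (RtoC PI / (RtoC a + s) - RtoC 0 = RtoC PI / (RtoC a + s))%C. ring. }
  assert (HN : forall t, 0 < t -> (RtoC t + s * s)%C <> RtoC 0).
  { intros t Ht. rewrite <- (sqrt_sqrt t) at 1 by lra. rewrite RtoC_mult. now apply sqr_plus_neq_0. }
  apply (is_RInt_gen_antiderivative (V := C_R_CompleteNormedModule) (fun t => H (sqrt t))).
  - intros t Ht.
    assert (Hr := sqrt_lt_R0 t Ht).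
    assert (D : is_derive sqrt t (/ (2 * sqrt t))).
    { auto_derive; [exact Ht|]. field. lra. }
    assert (E := is_derive_comp (K := R_AbsRing) (V := C_R_NormedModule) H sqrt t _ _ (H3 _ Hr) D).
    rewrite scal_R_C, <- RtoC_mult, sqrt_sqrt in E by lra.
    replace (RtoC (sqrt t / (a ^ 2 + t)) * (RtoC 1 / (RtoC t + s * s)))%C with
     (RtoC (/ (2 * sqrt t)) * (RtoC 2 * RtoC t / ((RtoC a * RtoC a + RtoC t) * (RtoC t + s * s))))%C; [exact E|].
    assert (HN' := HN t Ht).
    assert (R1 : sqrt t / (a ^ 2 + t) = / (2 * sqrt t) * (2 * t / (a * a + t))).
    { rewrite <- (sqrt_sqrt t) at 4 by lra. field. split; [nra | lra]. }
    rewrite R1, RtoC_mult. rewrite (RtoC_div (2 * t)), RtoC_mult, RtoC_plus, RtoC_mult by nra.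
    field. split; [exact HN'|]. rewrite <- RtoC_mult, <- RtoC_plus. intros Q. injection Q. nra.
  - intros t Ht.
    destruct (s * s)%C as [x y] eqn:Es.
    assert (HN' : (t + x) ^ 2 + y ^ 2 <> 0).
    { intros Q. apply (HN t Ht).
      assert (q1 := pow2_ge_0 (t + x)). assert (q2 := pow2_ge_0 y).
      assert (r1 : t + x = 0) by (apply Rsqr_0_uniq; unfold Rsqr; lra).
      assert (r2 : y = 0) by (apply Rsqr_0_uniq; unfold Rsqr; lra).
      apply injective_projections; simpl; lra. }
    pose (re u := sqrt u / (a ^ 2 + u) * ((u + x) / ((u + x) ^ 2 + y ^ 2))).
    pose (im u := - (sqrt u / (a ^ 2 + u) * (y / ((u + x) ^ 2 + y ^ 2)))).
    apply continuous_ext with (fun u => (re u, im u) : C).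
    { intros u. unfold re, im, Cdiv, Cinv, Cmult, Cplus, RtoC.
      apply injective_projections; simpl; replace (0 + y) with y by ring; unfold Rdiv; ring. }
    assert (Ha2 := pow2_ge_0 a).
    apply (filterlim_pair_C (F := locally t) re im (re t) (im t));
      apply (ex_derive_continuous (V := R_NormedModule));
      [unfold re | unfold im]; auto_derive; simpl in *; repeat split; try assumption; lra.
  - eapply filterlim_comp.
    + exact (filterlim_filter_le_1 (G := at_right 0) (F := locally 0) sqrt
        (filter_le_within _) (continuous_sqrt 0)).
    + rewrite sqrt_0. rewrite <- H2. exact H1.
  - eapply filterlim_comp; [|exact H4]. exact filterlim_sqrt_p.
Qed.

(** * The principal square root and the integral for G *)

(** Off the negative real axis the argument lies strictly between -PI and PI, so half of it has
    positive cosine; squaring doubles it back. *)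
Lemma Csqrt_spec (w : C) : ~ (Im w = 0 /\ Re w <= 0) ->
  0 < Re (Csqrt w) /\ (Csqrt w * Csqrt w)%C = w.
Proof.
  intros Hw.
  assert (Hm : 0 < Cmod w).
  { apply Cmod_gt_0. intros E. apply Hw. rewrite E. simpl. split; lra. }
  assert (Hsq := Cmod2_alt w).
  assert (Hc : -1 <= Re w / Cmod w <= 1).
  { assert (H := re_le_Cmod w). apply Rabs_le_between in H.
    split; [apply Rle_div_r | apply Rle_div_l]; lra. }
  assert (Hre : Cmod w * cos (acos (Re w / Cmod w)) = Re w).
  { rewrite cos_acos by exact Hc. field. lra. }
  assert (Hb := acos_bound (Re w / Cmod w)).
  assert (Hpi : acos (Re w / Cmod w) < PI).
  { destruct (proj2 Hb) as [H|H]; [exact H|]. exfalso. apply Hw.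
    rewrite H, cos_PI in Hre. split; nra. }
  assert (Him : Cmod w * sin (acos (Re w / Cmod w)) = Rabs (Im w)).
  { rewrite <- (Rabs_pos_eq (Cmod w * _)).
    - apply Rsqr_eq_abs_0.
      assert (H := sin2_cos2 (acos (Re w / Cmod w))). unfold Rsqr in *. nra.
    - apply Rmult_le_pos; [lra|]. apply sin_ge_0; lra. }
  assert (Hang : - PI < Carg w < PI /\ Cmod w * cos (Carg w) = Re w /\ Cmod w * sin (Carg w) = Im w).
  { unfold Carg. destruct (Rle_dec 0 (Im w)) as [H|H].
    - rewrite Rabs_pos_eq in Him by exact H. repeat split; try assumption. lra.
    - rewrite cos_neg, sin_neg. rewrite Rabs_left in Him by lra. repeat split; lra. }
  destruct Hang as [Hpi' [Hcos Hsin]].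
  assert (HE : exp (1 / 2 * ln (Cmod w)) * exp (1 / 2 * ln (Cmod w)) = Cmod w).
  { rewrite <- exp_plus. replace (1 / 2 * ln (Cmod w) + 1 / 2 * ln (Cmod w)) with (ln (Cmod w)) by field.
    now apply exp_ln. }
  assert (Hform : Csqrt w = (exp (1 / 2 * ln (Cmod w)) * cos (Carg w / 2),
                             exp (1 / 2 * ln (Cmod w)) * sin (Carg w / 2))).
  { unfold Csqrt, Cexp, Cln. cbn [Re Im fst snd Cmult RtoC].
    replace (1 / 2 * ln (Cmod w) - 0 * Carg w) with (1 / 2 * ln (Cmod w)) by ring.
    replace (1 / 2 * Carg w + 0 * ln (Cmod w)) with (Carg w / 2) by field. reflexivity. }
  rewrite Hform. split.
  - simpl. apply Rmult_lt_0_compat; [apply exp_pos|]. apply cos_gt_0; lra.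
  - replace (Carg w) with (2 * (Carg w / 2)) in Hcos, Hsin by field.
    rewrite cos_2a in Hcos. rewrite sin_2a in Hsin. rewrite <- HE in Hcos, Hsin.
    apply injective_projections; simpl; unfold Re, Im in *; rewrite <- ?Hcos, <- ?Hsin; ring.
Qed.

Lemma G_is_RInt_gen (a b : R) (z : C) : 0 <= a -> off_cut b z ->
  is_RInt_gen (V := C_R_NormedModule) (G_integrand a b z)
    (at_right 0) (Rbar_locally p_infty) (RtoC PI * G a b z)%C.
Proof.
  intros Ha Hz.
  destruct (Csqrt_spec (RtoC b - z)%C) as [H1 H2].
  { intros [E1 E2]. apply Hz. destruct z as [x y]. simpl in *. lra. }
  generalize (stieltjes_kernel_integral a (Csqrt (RtoC b - z)) Ha H1). rewrite H2.
  replace (RtoC PI * G a b z)%C with (RtoC PI / (RtoC a + Csqrt (RtoC b - z)))%C.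
  2:{ unfold G, Cdiv. ring. }
  apply is_RInt_gen_ext_positive. intros t _. unfold G_integrand. do 2 f_equal. ring.
Qed.

(** * The coefficient integrals *)

Lemma catalan2_integrand_ge0 a b n t : 0 < b -> 0 < t -> 0 <= catalan2_integrand a b n t.
Proof.
  intros Hb Ht. unfold catalan2_integrand.
  apply Rmult_le_pos; apply Rlt_le, Rdiv_lt_0_compat; try lra.
  - now apply sqrt_lt_R0.
  - assert (h := pow2_ge_0 a). lra.
  - apply pow_lt; lra.
Qed.

(** The case n = 0 is the real part of the integral for G at z = 0, and (b + t)^-n is at
    most b^-n. *)
Lemma ex_int_catalan2 (a b : R) (n : nat) : 0 <= a -> 0 < b ->
  ex_int_0_infty (V := R_NormedModule) (catalan2_integrand a b n).
Proof.
  intros Ha Hb.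
  assert (Ha2 := pow2_ge_0 a).
  assert (H0 : off_cut b (RtoC 0)) by (intros [_ H]; simpl in H; lra).
  assert (Hz := is_RInt_gen_linear (U := C_R_NormedModule) (V := R_NormedModule) _ _ _ _ _
    is_linear_Re (G_is_RInt_gen a b _ Ha H0)).
  apply ex_int_0_infty_dominated with
    (fun t => scal (V := R_NormedModule) ((/ b) ^ n) (Re (G_integrand a b (RtoC 0) t))).
  - intros t Ht. apply (ex_derive_continuous (V := R_NormedModule)).
    unfold catalan2_integrand. auto_derive.
    assert (0 < (b + t) ^ (n + 1)) by (apply pow_lt; lra). simpl in *.
    repeat split; lra.
  - intros t Ht. rewrite Rabs_pos_eq by now apply catalan2_integrand_ge0.
    change (catalan2_integrand a b n t <= (/ b) ^ n * Re (G_integrand a b (RtoC 0) t)).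
    replace (Re (G_integrand a b (RtoC 0) t)) with (catalan2_integrand a b 0 t).
    2:{ unfold G_integrand, catalan2_integrand.
        replace (RtoC 1 / (RtoC b + RtoC t - RtoC 0))%C with (RtoC (1 / (b + t) ^ (0 + 1))).
        - rewrite <- RtoC_mult. reflexivity.
        - simpl. rewrite Rmult_1_r, RtoC_div, RtoC_plus by lra. f_equal. ring. }
    assert (Hk : 0 <= sqrt t / (a ^ 2 + t)).
    { apply Rlt_le, Rdiv_lt_0_compat; [now apply sqrt_lt_R0 | lra]. }
    assert (Hi : 0 < / (b + t)) by (apply Rinv_0_lt_compat; lra).
    unfold catalan2_integrand.
    replace ((/ b) ^ n * (sqrt t / (a ^ 2 + t) * (1 / (b + t) ^ (0 + 1))))
      with (sqrt t / (a ^ 2 + t) * ((/ b) ^ n * / (b + t))) by (simpl; field; lra).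
    apply Rmult_le_compat_l; [exact Hk|].
    replace (1 / (b + t) ^ (n + 1)) with ((/ (b + t)) ^ n * / (b + t)).
    2:{ rewrite pow_add, pow_inv. simpl. field. split; [|apply pow_nonzero]; lra. }
    apply Rmult_le_compat_r; [lra|]. apply pow_incr. split; [lra|].
    apply Rinv_le_contravar; lra.
  - eexists. exact (is_RInt_gen_scal _ _ _ Hz).
Qed.

Definition catalan2 (a b : R) (n : nat) : R :=
  1 / PI * int_0_infty (V := R_CompleteNormedModule) (catalan2_integrand a b n).

Lemma catalan2_is_RInt_gen (a b : R) (n : nat) : 0 <= a -> 0 < b ->
  is_RInt_gen (V := R_NormedModule) (catalan2_integrand a b n)
    (at_right 0) (Rbar_locally p_infty) (PI * catalan2 a b n).
Proof.
  intros Ha Hb. replace (PI * catalan2 a b n) with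
    (int_0_infty (V := R_CompleteNormedModule) (catalan2_integrand a b n)).
  - apply (RInt_gen_correct (V := R_CompleteNormedModule)). now apply ex_int_catalan2.
  - assert (E : forall r : R, r = PI * (1 / PI * r)) by (intros r; field; apply PI_neq0).
    apply E.
Qed.

(** * The Taylor remainder as an integral *)

Lemma pow_n_Cpow (x : C) (n : nat) : pow_n (K := C_Ring) x n = (x ^ n)%C.
Proof. induction n as [|n IH]; simpl; [reflexivity | now rewrite IH]. Qed.

Definition remainder_integrand (a b : R) (x : C) (N : nat) (t : R) : C :=
  ((x / (RtoC b + RtoC t)) ^ N * G_integrand a b x t)%C.

Lemma Cpow_div_R (x : C) (r : R) (n : nat) : r <> 0 ->
  ((x / RtoC r) ^ n)%C = (x ^ n / RtoC (r ^ n))%C.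
Proof.
  intros Hr. unfold Cdiv.
  rewrite Cpow_mult_l, Cpow_inv, RtoC_pow; [reflexivity|].
  intros E; injection E; auto.
Qed.

(** With B = b + t, this is x / (B - x) = B / (B - x) - 1 up to the common factors, one
    step of the geometric progression. *)
Lemma remainder_integrand_succ (a b : R) (x : C) (N : nat) (t : R) :
  0 < b + t -> (RtoC b + RtoC t - x)%C <> RtoC 0 ->
  remainder_integrand a b x (S N) t =
  (remainder_integrand a b x N t
    - x ^ N * RtoC (catalan2_integrand a b N t))%C.
Proof.
  intros Hbt Hx. unfold remainder_integrand.
  rewrite <- RtoC_plus in *.
  rewrite !Cpow_div_R by lra.
  unfold G_integrand, catalan2_integrand. rewrite <- RtoC_plus.
  replace (N + 1)%nat with (S N) by lia.
  assert (HN : (b + t) ^ N <> 0) by (apply pow_nonzero; lra).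
  change (x ^ S N)%C with (x * x ^ N)%C.
  simpl ((b + t) ^ S N).
  rewrite (RtoC_mult (_ / _)), (RtoC_div 1 ((b + t) * _)), !RtoC_mult
    by (apply Rmult_integral_contrapositive; split; lra).
  field. repeat split; try assumption; intros E; injection E; auto; lra.
Qed.

Lemma shifted_neq_0 (b t : R) (x : C) : 0 < t -> Cmod x < b / 2 -> (RtoC b + RtoC t - x)%C <> RtoC 0.
Proof.
  intros Ht Hx E. assert (H := re_le_Cmod x). apply Rabs_le_between in H.
  apply (f_equal Re) in E. simpl in E. destruct x as [p q]. simpl in *.
  assert (H' := Cmod_ge_0 (p, q)). lra.
Qed.

Lemma disk_off_cut (b : R) (x : C) : Cmod x < b / 2 -> off_cut b x.
Proof.
  intros Hx [_ E]. assert (H := re_le_Cmod x). apply Rabs_le_between in H.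
  assert (H' := Cmod_ge_0 x). lra.
Qed.

Lemma remainder_is_RInt_gen (a b : R) (x : C) (N : nat) :
  0 <= a -> 0 < b -> Cmod x < b / 2 ->
  is_RInt_gen (V := C_R_NormedModule) (remainder_integrand a b x (S N))
    (at_right 0) (Rbar_locally p_infty)
    (RtoC PI * (G a b x - sum_n (G := C_AbelianMonoid)
       (fun n => x ^ n * RtoC (catalan2 a b n))%C N))%C.
Proof.
  intros Ha Hb Hx.
  assert (Hstep : forall M l,
    is_RInt_gen (V := C_R_NormedModule) (remainder_integrand a b x M)
      (at_right 0) (Rbar_locally p_infty) l ->
    is_RInt_gen (V := C_R_NormedModule) (remainder_integrand a b x (S M))
      (at_right 0) (Rbar_locally p_infty)
      (l - x ^ M * RtoC (PI * catalan2 a b M))%C).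
  { intros M l HM.
    apply is_RInt_gen_ext_positive with (fun t => minus (G := C_R_NormedModule)
      (remainder_integrand a b x M t)
      (x ^ M * RtoC (catalan2_integrand a b M t))%C).
    - intros t Ht. rewrite remainder_integrand_succ; [reflexivity | lra | now apply shifted_neq_0].
    - apply (is_RInt_gen_minus (V := C_R_NormedModule)); [exact HM|].
      apply (is_RInt_gen_linear (U := C_R_NormedModule) (V := C_R_NormedModule) _ _ _ _ _ (is_linear_Cmult _)).
      apply (is_RInt_gen_linear (U := R_NormedModule) (V := C_R_NormedModule) _ _ _ _ _ is_linear_RtoC).
      now apply catalan2_is_RInt_gen. }
  induction N as [|N IH].
  - rewrite sum_O.
    replace (RtoC PI * _)%C with
      (RtoC PI * G a b x - x ^ 0 * RtoC (PI * catalan2 a b 0))%C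
      by (rewrite RtoC_mult; ring).
    apply Hstep.
    apply is_RInt_gen_ext_positive with (G_integrand a b x).
    + intros t _. symmetry. exact (Cmult_1_l (G_integrand a b x t)).
    + apply G_is_RInt_gen; [exact Ha | now apply disk_off_cut].
  - rewrite sum_Sn. apply Hstep in IH.
    rewrite RtoC_mult in IH.
    assert (E : forall g p q c : C,
      (RtoC PI * (g - p) - q * (RtoC PI * c) = RtoC PI * (g - (p + q * c)))%C) by (intros; ring).
    rewrite E in IH. exact IH.
Qed.

(** The factor (|x| / (b + t))^(N+1) <= 2^-(N+1) and the estimate
    |b + t - x| >= (b + t) / 2 bound the remainder integrand by 2^-N times the integrand of C_0. *)
Lemma remainder_bound (a b : R) (x : C) (N : nat) :
  0 <= a -> 0 < b -> Cmod x < b / 2 ->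
  Cmod (G a b x - sum_n (G := C_AbelianMonoid)
       (fun n => x ^ n * RtoC (catalan2 a b n))%C N)%C <= catalan2 a b 0 * (1 / 2) ^ N.
Proof.
  intros Ha Hb Hx.
  assert (Hpi := PI_RGT_0).
  apply Rmult_le_reg_l with PI; [exact Hpi|].
  rewrite <- (Rabs_pos_eq PI) at 1 by lra. rewrite <- Cmod_R, <- Cmod_mult, <- norm_C_R.
  replace (PI * (catalan2 a b 0 * (1 / 2) ^ N)) with ((1 / 2) ^ N * (PI * catalan2 a b 0)) by ring.
  apply (RInt_gen_norm (V := C_R_CompleteNormedModule) (Fa := at_right 0) (Fb := Rbar_locally p_infty)
    (remainder_integrand a b x (S N)) (fun t => scal (V := R_NormedModule) ((1 / 2) ^ N) (catalan2_integrand a b 0 t))).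
  - refine (filter_imp (F := zero_infty) _ _ _ zero_infty_ordered). intros u Hu. lra.
  - refine (filter_imp (F := zero_infty) _ _ _ zero_infty_ordered).
    intros [u v] Huv t Ht. simpl in Huv, Ht.
    assert (Ht0 : 0 < t) by lra. clear u v Huv Ht.
    change (norm (V := C_R_NormedModule) (remainder_integrand a b x (S N) t)
      <= (1 / 2) ^ N * catalan2_integrand a b 0 t).
    rewrite norm_C_R. unfold remainder_integrand, G_integrand, catalan2_integrand.
    assert (Hne := shifted_neq_0 b t x Ht0 Hx).
    assert (Ha2 := pow2_ge_0 a).
    assert (Hk : 0 <= sqrt t / (a ^ 2 + t)).
    { apply Rlt_le, Rdiv_lt_0_compat; [now apply sqrt_lt_R0 | lra]. }
    rewrite <- RtoC_plus in *.
    assert (HbtC : RtoC (b + t) <> RtoC 0) by (intros E; injection E; lra).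
    rewrite !Cmod_mult, Cmod_pow, !Cmod_div, Cmod_1, !Cmod_R by assumption.
    rewrite (Rabs_pos_eq (b + t)), (Rabs_pos_eq (sqrt t / _)) by (assumption || lra).
    assert (Hd : (b + t) / 2 <= Cmod (RtoC (b + t) - x)).
    { assert (T := Cmod_triangle (RtoC (b + t) - x) x).
      replace (RtoC (b + t) - x + x)%C with (RtoC (b + t)) in T by ring.
      rewrite Cmod_R, Rabs_pos_eq in T by lra. lra. }
    assert (Hq : 0 <= Cmod x / (b + t) <= 1 / 2).
    { assert (h := Cmod_ge_0 x). split.
      - apply Rmult_le_pos; [lra|]. apply Rlt_le, Rinv_0_lt_compat. lra.
      - apply Rle_div_l; lra. }
    assert (Hp : (Cmod x / (b + t)) ^ S N <= (1 / 2) ^ S N) by now apply pow_incr.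
    assert (Hi : 1 / Cmod (RtoC (b + t) - x) <= 2 * (1 / (b + t) ^ (0 + 1))).
    { simpl. apply Rle_div_l; [lra|].
      replace (2 * (1 / ((b + t) * 1)) * Cmod (RtoC (b + t) - x))
        with (Cmod (RtoC (b + t) - x) * 2 / (b + t)) by (field; lra).
      apply Rle_div_r; lra. }
    replace ((1 / 2) ^ N * (sqrt t / (a ^ 2 + t) * (1 / (b + t) ^ (0 + 1))))
      with ((1 / 2) ^ S N * (sqrt t / (a ^ 2 + t) * (2 * (1 / (b + t) ^ (0 + 1)))))
      by (simpl; field; split; lra).
    assert (H0 : 0 <= 1 / Cmod (RtoC (b + t) - x)).
    { apply Rlt_le, Rdiv_lt_0_compat; lra. }
    apply Rmult_le_compat.
    + apply pow_le; lra.
    + now apply Rmult_le_pos.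
    + exact Hp.
    + now apply Rmult_le_compat_l.
  - now apply remainder_is_RInt_gen.
  - apply (is_RInt_gen_scal (V := R_NormedModule)). now apply catalan2_is_RInt_gen.
Qed.

Lemma catalan2_series (a b : R) (x : C) : 0 <= a -> 0 < b -> Cmod x < b / 2 ->
  is_pseries (K := C_AbsRing) (V := C_NormedModule) (fun n => RtoC (catalan2 a b n)) x (G a b x).
Proof.
  intros Ha Hb Hx.
  assert (Hlim : is_lim_seq (fun N => catalan2 a b 0 * (1 / 2) ^ N) (Finite 0)).
  { replace (Finite 0) with (Rbar_mult (catalan2 a b 0) 0) by (simpl; f_equal; ring).
    apply is_lim_seq_scal_l. apply is_lim_seq_geom. rewrite Rabs_pos_eq; lra. }
  intros P [eps HP].
  assert (He : eventually (fun N => ball 0 eps (catalan2 a b 0 * (1 / 2) ^ N)))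
    by exact (Hlim _ (locally_ball 0 eps)).
  refine (filter_imp (F := eventually) _ _ _ He). intros N HN.
  apply HP. apply C_NormedModule_mixin_compat1.
  rewrite (sum_n_ext _ (fun n => x ^ n * RtoC (catalan2 a b n))%C).
  2:{ intros n. now rewrite <- pow_n_Cpow. }
  rewrite <- Cmod_opp.
  change (Rabs (catalan2 a b 0 * (1 / 2) ^ N - 0) < eps) in HN. apply Rabs_def2 in HN.
  match goal with |- Cmod (- minus ?u ?v) < _ => replace (- minus u v)%C with (v - u)%C end.
  - eapply Rle_lt_trans; [now apply remainder_bound | lra].
  - match goal with |- _ = (- minus ?u ?v)%C => change (v - u = - (u - v))%C end. ring.
Qed.

(** * Uniqueness of the coefficients *)

(** At real x the powers x^n are real scalars, so a real-linear map such as [Re] or [Im]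
    passes through the series. *)
Lemma is_pseries_linear_real (L : C -> R) (c : nat -> C) (x : R) (l : C) :
  is_linear (U := C_R_NormedModule) (V := R_NormedModule) L ->
  is_pseries (K := C_AbsRing) (V := C_NormedModule) c (RtoC x) l ->
  is_pseries (K := R_AbsRing) (V := R_NormedModule) (fun n => L (c n)) x (L l).
Proof.
  intros HL Hc.
  apply filterlim_ext with (fun N => L (sum_n (G := C_AbelianMonoid)
     (fun k => scal (V := C_NormedModule) (pow_n (K := C_AbsRing) (RtoC x) k) (c k)) N)).
  - assert (Hterm : forall k, L (scal (V := C_NormedModule) (pow_n (K := C_AbsRing) (RtoC x) k) (c k))
      = scal (V := R_NormedModule) (pow_n (K := R_AbsRing) x k) (L (c k))).
    { intros k. rewrite <- (linear_scal (U := C_R_NormedModule) (V := R_NormedModule) L HL). f_equal. rewrite scal_R_C, pow_n_pow, RtoC_pow, <- pow_n_Cpow.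
      reflexivity. }
    induction x0 as [|N IH].
    + rewrite !sum_O. apply Hterm.
    + rewrite !sum_Sn, <- IH, <- Hterm. exact (linear_plus (U := C_R_NormedModule) (V := R_NormedModule) L HL _ _).
  - eapply filterlim_comp; [exact Hc | exact (linear_cont (U := C_R_NormedModule) (V := R_NormedModule) L l HL)].
Qed.

(** Convergence at a nonzero point forces a positive radius of convergence; from there
    the u n and v n are Taylor coefficients at 0 of the common sum. *)
Lemma real_pseries_unique (u v : nat -> R) (g : R -> R) (r : R) : 0 < r ->
  (forall x, Rabs x < r -> is_pseries (K := R_AbsRing) (V := R_NormedModule) u x (g x)) ->
  (forall x, Rabs x < r -> is_pseries (K := R_AbsRing) (V := R_NormedModule) v x (g x)) ->
  forall n, u n = v n.
Proof.
  intros Hr Hu Hv n.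
  assert (Hrad : forall w, (forall x, Rabs x < r ->
     is_pseries (K := R_AbsRing) (V := R_NormedModule) w x (g x)) -> Rbar_lt 0 (CV_radius w)).
  { intros w Hw. apply Rbar_not_le_lt. intros H.
    assert (Hr2 : Rabs (r / 2) = r / 2) by (rewrite Rabs_pos_eq; lra).
    apply (CV_disk_outside w (r / 2)).
    - apply Rbar_le_lt_trans with (1 := H). simpl. lra.
    - apply is_lim_seq_ext with (fun k => scal (V := R_NormedModule) (pow_n (K := R_AbsRing) (r / 2) k) (w k)).
      + intros k. rewrite pow_n_pow. apply Rmult_comm.
      + apply ex_series_lim_0. eexists. apply Hw. lra. }
  apply PSeries_ext_recip; [now apply Hrad | now apply Hrad |].
  exists (mkposreal r Hr). intros x Hx.
  change (Rabs (x - 0) < r) in Hx. rewrite Rminus_0_r in Hx.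
  transitivity (g x); [|symmetry]; apply is_pseries_unique; auto.
Qed.

Theorem theorem3p1 (a b : R) (ha : 0 <= a) (hb : 0 < b) :
  (forall z : C, off_cut b z ->
     ex_int_0_infty (V := C_R_NormedModule) (G_integrand a b z) /\
     G a b z =
       (RtoC (1 / PI) *
          int_0_infty (V := C_R_CompleteNormedModule) (G_integrand a b z))%C) /\
  (exists c : nat -> C, is_catalan2 a b c) /\
  (forall c : nat -> C, is_catalan2 a b c ->
     forall n : nat,
       ex_int_0_infty (V := R_NormedModule) (catalan2_integrand a b n) /\
       c n =
         RtoC (1 / PI *
           int_0_infty (V := R_CompleteNormedModule)
             (catalan2_integrand a b n))).
Proof.
  assert (Hb2 : 0 < b / 2) by lra.
  split; [|split].
  - intros z Hz. assert (HG := G_is_RInt_gen a b z ha Hz). split.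
    + eexists. exact HG.
    + unfold int_0_infty.
      rewrite (is_RInt_gen_unique (V := C_R_CompleteNormedModule) _ _ HG).
      rewrite Cmult_assoc, <- RtoC_mult.
      replace (1 / PI * PI) with 1 by (field; apply PI_neq0). ring.
  - exists (fun n => RtoC (catalan2 a b n)).
    (* A ball of C is a square, contained in the disk of radius sqrt 2 times its half-side;
       b / 4 keeps that disk inside |x| < b / 2. *)
    assert (Hb4 : 0 < b / 4) by lra.
    exists (mkposreal _ Hb4). intros x Hx. apply catalan2_series; try assumption.
    apply C_NormedModule_mixin_compat2 in Hx. simpl in Hx.
    change (Cmod ((x : C) - RtoC 0)%C < sqrt 2 * (b / 4)) in Hx.
    replace ((x : C) - RtoC 0)%C with (x : C) in Hx by (apply injective_projections; simpl; ring).
    assert (H2 : sqrt 2 < 2).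
    { rewrite <- (sqrt_square 2) at 2 by lra. apply sqrt_lt_1; lra. }
    assert (H3 := Rmult_lt_compat_r _ _ _ Hb4 H2).
    apply Rlt_trans with (1 := Hx). lra.
  - intros c [eps Hc] n. split; [now apply ex_int_catalan2|].
    change (c n = RtoC (catalan2 a b n)).
    assert (Hr : 0 < Rmin eps (b / 2)) by (apply Rmin_pos; [apply cond_pos | exact Hb2]).
    assert (Huniq : forall L : C -> R, is_linear (U := C_R_NormedModule) (V := R_NormedModule) L ->
      L (c n) = L (RtoC (catalan2 a b n))).
    { intros L HL.
      apply (real_pseries_unique (fun n => L (c n)) (fun n => L (RtoC (catalan2 a b n)))
        (fun x => L (G a b (RtoC x))) _ Hr); intros x Hx;
        apply is_pseries_linear_real; try exact HL.
      - apply Hc. assert (h := Rmin_l eps (b / 2)). split.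
        + change (Rabs (x - 0) < eps). rewrite Rminus_0_r. lra.
        + apply ball_center.
      - apply catalan2_series; try assumption. rewrite Cmod_R.
        assert (h := Rmin_r eps (b / 2)). lra. }
    apply injective_projections.
    + exact (Huniq Re is_linear_Re).
    + exact (Huniq Im (is_linear_snd (K := R_AbsRing) (U := R_NormedModule) (V := R_NormedModule))).
Qed.
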